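(* Let $\mathfrak g=\mathfrak{so}(N)$, $N=2n+1$, $m\in\mathbb N$, $m\le n$, and let $$A=\pm\Bigl(\sum_{i=1}^m q^{-m}(1-q^{-N+2m})e_{ii}+\sum_{m<i<m'}q^{-m}e_{ii}+\sum_{i\le m\text{ or }i'\le m}y_ie_{ii'}\Bigr),\qquad y_iy_{i'}=q^{-N},$$ where $i'=N+1-i$. Let $U_q(\mathfrak k)\subset U_q(\mathfrak g)$ be the subalgebra generated by $e_i,f_i,q^{\pm h_i}$ with $m+1\le i\le n$, and by $X_{\alpha_i}=q^{h_{\tilde\alpha_i}-h_{\alpha_i}}e_i+c_{\alpha_i}F_{\tilde\alpha_i}$, $q^{\pm(h_{\tilde\alpha_i}-h_{\alpha_i})}$ for $1\le i\le m$, with the following data: • for $i<m$: $\tilde\alpha_i=\alpha_i$, $F_{\tilde\alpha_i}=F_i$, $c_{\alpha_i}=-\dfrac{q\,y_{i+1}}{y_i}$; • if $m=n$: $\tilde\alpha_m=\alpha_n$, $F_{\tilde\alpha_m}=F_n$, $c_{\alpha_m}=-\dfrac{1}{y_mq^m}$; • if $m<n$: $\tilde\alpha_m=\alpha_m+2\sum_{l=m+1}^n\alpha_l$, $c_{\alpha_m}=\dfrac{(-1)^{n-m+1}}{y_mq^{m+1}}$, and $$F_{\tilde\alpha_m}=[\dots[[[\dots[[F_m,F_{m+1}]_q,F_{m+2}]_q,\dots,F_n]_q,F_n],F_{n-1}]_q,\dots,F_{m+1}]_q\quad (m<n-1),$$ $$F_{\tilde\alpha_m}=[[F_{n-1},F_n]_q,F_n]\quad(m=n-1).$$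 Then $U_q(\mathfrak k)$ stabilizes $A$: $\pi(x)A=A\pi(x)$ for all $x\in U_q(\mathfrak k)$, where $\pi$ is the natural representation of $U_q(\mathfrak g)$ on $\mathbb C^N$.
   Context: $q\in\mathbb C$ is nonzero and not a root of unity. $U_q(\mathfrak{so}(2n+1))$ has generators $e_i,f_i,q^{\pm h_i}$, $1\le i\le n$, for the simple roots $\alpha_i=\varepsilon_i-\varepsilon_{i+1}$ ($i<n$), $\alpha_n=\varepsilon_n$, $(\varepsilon_i,\varepsilon_j)=\delta_{ij}$: $q^{h_i}e_jq^{-h_i}=q^{(\alpha_i,\alpha_j)}e_j$, $q^{h_i}f_jq^{-h_i}=q^{-(\alpha_i,\alpha_j)}f_j$, $[e_i,f_j]=\delta_{ij}\frac{q^{h_i}-q^{-h_i}}{q-q^{-1}}$ for all $i,j$, the $q^{\pm h_i}$ commute, plus the quantum Serre relations. For $\beta=\sum k_i\alpha_i$, $q^{h_\beta}=\prod_i(q^{h_i})^{k_i}$. Notation: $F_i=q^{h_i}f_i$, $[x,y]_a=xy-a\,yx$, $[x,y]=[x,y]_1$. With matrix units $e_{jk}$ (two indices), the natural representation $\pi:U_q(\mathfrak g)\to\mathrm{End}(\mathbb C^N)$ is $e_i\mapsto e_{i,i+1}-e_{(i+1)',i'}$ for $i\le n$, $f_i\mapsto e_{i+1,i}-e_{i',(i+1)'}$, $q^{h_i}\mapsto\sum_jq^{\delta_{ji}-\delta_{ji'}-\delta_{j,i+1}+\delta_{j,(i+1)'}}e_{jj}$ for $i<n$, $q^{h_n}\mapsto\sum_jq^{\delta_{jn}-\delta_{jn'}}e_{jj}$.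 *)

(* Defs.v *)
From HB Require Import structures.
From mathcomp Require Import all_boot all_order all_algebra.
From mathcomp Require Import generic_quotient ring_quotient zify ring.
From mathcomp Require Import boolp.
From mathcomp.multinomials Require Import monalg.

Set Implicit Arguments.
Unset Strict Implicit.
Unset Printing Implicit Defensive.

Import GRing.Theory.
Local Open Scope ring_scope.
Local Open Scope quotient_scope.

Definition freealg (K : fieldType) (G : choiceType) : Type :=
  {malg K[{fmonom G}]}.

Section FreeAlgebra.
Context (K : fieldType) (G : choiceType).

HB.instance Definition _ := GRing.Lalgebra.on (freealg K G).

Lemma freealg_scalerAr (c : K) (x y : {malg K[{fmonom G}]}) :
  c *: (x * y) = x * (c *: y).
Proof.
apply/malgP => w; rewrite [LHS]mcoeffZ [X in c * X]mcoeffMl mulr_sumr.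
rewrite [RHS](mcoeffMlw w (finmap.fsubset_refl _) (msuppZ_le c y)).
apply: eq_bigr => u _; rewrite mulr_sumr; apply: eq_bigr => v _.
by rewrite mcoeffZ mulrnAr mulrCA.
Qed.

HB.instance Definition _ :=
  GRing.Lalgebra_isAlgebra.Build K (freealg K G) freealg_scalerAr.

Definition fgen (g : G) : freealg K G := << fmu g >>.

Context (S : algType K) (h : G -> S).

Definition word_eval (w : {fmonom G}) : S := \prod_(g <- (w : seq G)) h g.

Lemma word_eval_mmorphism : mmorphism word_eval.
Proof.
split=> [w1 w2|]; first by rewrite /word_eval fmM big_cat.
by rewrite /word_eval fm1 big_nil.
Qed.

HB.instance Definition _ :=
  isMultiplicative.Build {fmonom G} S word_eval word_eval_mmorphism.

(* The algebra morphism freealg K G -> S that extends h.                      *)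
Definition free_eval : freealg K G -> S := mmap (GRing.in_alg S) word_eval.

Lemma free_eval_zmod_morphism : zmod_morphism free_eval.
Proof. by move=> x y; rewrite /free_eval mmapB. Qed.

Lemma free_eval_monoid_morphism : monoid_morphism free_eval.
Proof.
have commr (x : freealg K G) (w w' : {fmonom G}) :
    GRing.comm (GRing.in_alg S x@_w) (word_eval w').
  by rewrite /GRing.comm /GRing.in_alg /= mulr_algl mulr_algr.
have [evM ev1] := commr_mmap_is_multiplicative commr.
by split=> [|x y]; [apply: ev1|apply: evM].
Qed.

Lemma free_eval_scalable : scalable free_eval.
Proof. by move=> c x; rewrite /free_eval mmapZ /= mulr_algl. Qed.

HB.instance Definition _ :=
  GRing.isZmodMorphism.Build (freealg K G) S free_eval free_eval_zmod_morphism.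
HB.instance Definition _ := GRing.isMonoidMorphism.Build (freealg K G) S
  free_eval free_eval_monoid_morphism.
HB.instance Definition _ :=
  GRing.isScalable.Build K (freealg K G) S *:%R free_eval free_eval_scalable.

Lemma free_eval_gen g : free_eval (fgen g) = h g.
Proof.
by rewrite /free_eval /fgen mmapU /= scale1r mul1r /word_eval fmU big_seq1.
Qed.

End FreeAlgebra.

Section RelIdeal.
Context (K : fieldType) (A : algType K) (rel : A -> A -> Prop).

(* The two-sided ideal generated by the x - y with rel x y.                   *)
Inductive rel_ideal : A -> Prop :=
| rel_ideal_gen a b x y : rel x y -> rel_ideal (a * (x - y) * b)
| rel_ideal0 : rel_ideal 0
| rel_idealD u v : rel_ideal u -> rel_ideal v -> rel_ideal (u + v).

Definition in_rel_ideal : {pred A} := fun x => `[< rel_ideal x >].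

Lemma rel_idealMl c u : u \in in_rel_ideal -> c * u \in in_rel_ideal.
Proof.
move=> /asboolP Iu; apply/asboolP.
elim: Iu => [a b x y xy||v w _ cv _ cw].
- by rewrite !mulrA -(mulrA (c * a)) mulrA; apply: rel_ideal_gen.
- by rewrite mulr0; apply: rel_ideal0.
- by rewrite mulrDr; apply: rel_idealD.
Qed.

Lemma rel_idealMr c u : u \in in_rel_ideal -> u * c \in in_rel_ideal.
Proof.
move=> /asboolP Iu; apply/asboolP.
elim: Iu => [a b x y xy||v w _ cv _ cw].
- by rewrite -mulrA; apply: rel_ideal_gen.
- by rewrite mul0r; apply: rel_ideal0.
- by rewrite mulrDl; apply: rel_idealD.
Qed.

Lemma in_rel_ideal_zmod_closed : zmod_closed in_rel_ideal.
Proof.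
split=> [|u v Iu Iv]; first by apply/asboolP; apply: rel_ideal0.
have /asboolP Nv := rel_idealMl (-1) Iv; rewrite mulN1r in Nv.
by apply/asboolP; apply: rel_idealD => //; apply/asboolP.
Qed.

HB.instance Definition _ :=
  GRing.isZmodClosed.Build A in_rel_ideal in_rel_ideal_zmod_closed.

Lemma rel_ideal_morph (S : algType K) (phi : {lrmorphism A -> S}) :
    (forall x y, rel x y -> phi x = phi y) ->
  forall u, u \in in_rel_ideal -> phi u = 0.
Proof.
move=> phi_rel u /asboolP; elim=> [a b x y xy||v w _ v0 _ w0].
- by rewrite !rmorphM rmorphB /= (phi_rel _ _ xy) subrr mulr0 mul0r.
- exact: rmorph0.
- by rewrite rmorphD /= v0 w0 addr0.
Qed.

(* MathComp algebras are nonzero rings, hence the properness argument.        *)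
Definition quot_alg (_ : 1 \notin in_rel_ideal) : Type :=
  Quotient.quot in_rel_ideal.

Context (I_proper : 1 \notin in_rel_ideal).
Local Notation Q := (quot_alg I_proper).

HB.instance Definition _ := GRing.Zmodule.on Q.
HB.instance Definition _ : EqQuotient A (Quotient.equiv in_rel_ideal) Q :=
  EqQuotient.on Q.

Definition quot_pi (x : A) : Q := \pi_Q x.

Lemma quot_piP x y : (quot_pi x = quot_pi y) <-> (x - y \in in_rel_ideal).
Proof. by rewrite Quotient.idealrBE; split=> /eqP. Qed.

Lemma quot_piK x : quot_pi (repr x) = x. Proof. exact: reprK. Qed.

Lemma quot_pi_zmod_morphism : zmod_morphism quot_pi.
Proof. by move=> x y; rewrite /quot_pi !piE. Qed.

HB.instance Definition _ :=
  GRing.isZmodMorphism.Build A Q quot_pi quot_pi_zmod_morphism.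

Definition quot_one : Q := quot_pi 1.
Definition quot_mul (x y : Q) : Q := quot_pi (repr x * repr y).
Definition quot_scale (c : K) (x : Q) : Q := quot_pi (c *: repr x).

Lemma quot_reprB x : repr (quot_pi x) - x \in in_rel_ideal.
Proof. by apply/quot_piP; rewrite quot_piK. Qed.

Lemma quot_piM x y : quot_mul (quot_pi x) (quot_pi y) = quot_pi (x * y).
Proof.
apply/quot_piP; set x' := repr _; set y' := repr _.
have -> : x' * y' - x * y = (x' - x) * y' + x * (y' - y).
  by rewrite mulrBl mulrBr addrA subrK.
by apply: rpredD; [apply: rel_idealMr|apply: rel_idealMl]; apply: quot_reprB.
Qed.

Lemma quot_piZ c x : quot_scale c (quot_pi x) = quot_pi (c *: x).
Proof.
apply/quot_piP; rewrite -scalerBr -mulr_algl.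
exact/rel_idealMl/quot_reprB.
Qed.

Lemma quot_piW (P : Q -> Prop) : (forall x, P (quot_pi x)) -> forall x, P x.
Proof. by move=> Ppi x; rewrite -[x]quot_piK. Qed.

Lemma quot_mulA : associative quot_mul.
Proof. by do 3!elim/quot_piW=> ?; rewrite !quot_piM mulrA. Qed.

Lemma quot_mul1r : left_id quot_one quot_mul.
Proof. by elim/quot_piW=> ?; rewrite quot_piM mul1r. Qed.

Lemma quot_mulr1 : right_id quot_one quot_mul.
Proof. by elim/quot_piW=> ?; rewrite quot_piM mulr1. Qed.

Lemma quot_mulDl : left_distributive quot_mul +%R.
Proof.
by do 3!elim/quot_piW=> ?; rewrite -raddfD !quot_piM -raddfD mulrDl.
Qed.

Lemma quot_mulDr : right_distributive quot_mul +%R.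
Proof.
by do 3!elim/quot_piW=> ?; rewrite -raddfD !quot_piM -raddfD mulrDr.
Qed.

Lemma quot_one_neq0 : quot_one != 0.
Proof.
apply/negP => /eqP; rewrite -(raddf0 quot_pi) => /quot_piP.
by rewrite subr0; apply/negP.
Qed.

HB.instance Definition _ := GRing.Zmodule_isNzRing.Build Q
  quot_mulA quot_mul1r quot_mulr1 quot_mulDl quot_mulDr quot_one_neq0.

Lemma quot_scalerA a b x :
  quot_scale a (quot_scale b x) = quot_scale (a * b) x.
Proof. by elim/quot_piW: x => x; rewrite !quot_piZ scalerA. Qed.

Lemma quot_scale1r : left_id 1 quot_scale.
Proof. by elim/quot_piW=> ?; rewrite quot_piZ scale1r. Qed.

Lemma quot_scalerDr : right_distributive quot_scale +%R.
Proof.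
move=> c; do 2!elim/quot_piW=> ?.
by rewrite -raddfD !quot_piZ -raddfD scalerDr.
Qed.

Lemma quot_scalerDl x : {morph quot_scale^~ x : a b / a + b}.
Proof. by elim/quot_piW: x => x a b; rewrite !quot_piZ -raddfD scalerDl. Qed.

HB.instance Definition _ := GRing.Zmodule_isLmodule.Build K Q
  quot_scalerA quot_scale1r quot_scalerDr quot_scalerDl.

Lemma quot_scalerAl (c : K) (x y : Q) : c *: (x * y) = (c *: x) * y.
Proof.
elim/quot_piW: x => x; elim/quot_piW: y => y.
by rewrite /GRing.mul /GRing.scale /= !(quot_piM, quot_piZ) scalerAl.
Qed.

HB.instance Definition _ := GRing.Lmodule_isLalgebra.Build K Q quot_scalerAl.

Lemma quot_scalerAr (c : K) (x y : Q) : c *: (x * y) = x * (c *: y).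
Proof.
elim/quot_piW: x => x; elim/quot_piW: y => y.
by rewrite /GRing.mul /GRing.scale /= !(quot_piM, quot_piZ) scalerAr.
Qed.

HB.instance Definition _ := GRing.Lalgebra_isAlgebra.Build K Q quot_scalerAr.

Lemma quot_pi_monoid_morphism : monoid_morphism quot_pi.
Proof. by split=> // x y; rewrite -quot_piM. Qed.

Lemma quot_pi_scalable : scalable quot_pi.
Proof. by move=> c x; rewrite -quot_piZ. Qed.

HB.instance Definition _ :=
  GRing.isMonoidMorphism.Build A Q quot_pi quot_pi_monoid_morphism.
HB.instance Definition _ :=
  GRing.isScalable.Build K A Q *:%R quot_pi quot_pi_scalable.

Section Lift.
Context (S : algType K) (phi : {lrmorphism A -> S}).

Definition quot_lift (_ : forall x y, rel x y -> phi x = phi y) (x : Q) : S :=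
  phi (repr x).

Context (phi_rel : forall x y, rel x y -> phi x = phi y).
Local Notation lift := (quot_lift phi_rel).

Lemma quot_lift_pi x : lift (quot_pi x) = phi x.
Proof.
apply/eqP; rewrite -subr_eq0 -rmorphB; apply/eqP.
exact: (rel_ideal_morph phi_rel) (quot_reprB x).
Qed.

Lemma quot_lift_zmod_morphism : zmod_morphism lift.
Proof.
by do 2!elim/quot_piW=> ?; rewrite -raddfB !quot_lift_pi rmorphB.
Qed.

Lemma quot_lift_monoid_morphism : monoid_morphism lift.
Proof.
split=> [|x y]; first by rewrite -(rmorph1 quot_pi) quot_lift_pi rmorph1.
elim/quot_piW: x => x; elim/quot_piW: y => y.
by rewrite -rmorphM !quot_lift_pi rmorphM.
Qed.

Lemma quot_lift_scalable : scalable lift.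
Proof.
by move=> c; elim/quot_piW=> x; rewrite -linearZ !quot_lift_pi linearZ.
Qed.

HB.instance Definition _ :=
  GRing.isZmodMorphism.Build Q S lift quot_lift_zmod_morphism.
HB.instance Definition _ :=
  GRing.isMonoidMorphism.Build Q S lift quot_lift_monoid_morphism.
HB.instance Definition _ :=
  GRing.isScalable.Build K Q S *:%R lift quot_lift_scalable.

End Lift.

End RelIdeal.

(* Below, indices are 0-based: i : 'I_n stands for the simple root            *)
(* alpha_(i+1) of so(2n+1).                                                   *)

(* Coordinates of the simple roots in the basis (varepsilon_k): the second    *)
(* term vanishes for the last root, since n is not a value of k : 'I_n.       *)
Definition eps_coord n (i k : 'I_n) : int :=
  (k == i)%:R - (k == i.+1 :> nat)%:R.

Definition root_form n (i j : 'I_n) : int :=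
  \sum_(k < n) eps_coord i k * eps_coord j k.

(* The defining relations, for e_i, f_i, k_i = q^(h_i), kV_i = q^(- h_i).     *)
(* The last six are the quantum Serre relations                               *)
(*   \sum_l (-1)^l [1 - a_ij, l]_(q_i) e_i^(1 - a_ij - l) e_j e_i^l = 0,      *)
(* with a_ij = 2 (alpha_i, alpha_j) / (alpha_i, alpha_i) and                  *)
(* q_i = q^((alpha_i, alpha_i) / 2), so that [2]_(q_i) = q + q^-1 for a long  *)
(* root alpha_i and [3]_(q_i) = q + 1 + q^-1 for the short one.               *)
Inductive uq_rel (K : fieldType) (A : algType K) n (q : K)
    (e f k kV : 'I_n -> A) : A -> A -> Prop :=
| uq_kkV i : uq_rel q e f k kV (k i * kV i) 1
| uq_kVk i : uq_rel q e f k kV (kV i * k i) 1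
| uq_kk i j : uq_rel q e f k kV (k i * k j) (k j * k i)
| uq_ke i j : uq_rel q e f k kV
    (k i * e j * kV i) (q ^ root_form i j *: e j)
| uq_kf i j : uq_rel q e f k kV
    (k i * f j * kV i) (q ^ (- root_form i j) *: f j)
| uq_ef i j : uq_rel q e f k kV
    (e i * f j - f j * e i)
    (if i == j then (q - q^-1)^-1 *: (k i - kV i) else 0)
| uq_serre0_e (i j : 'I_n) of (i.+1 < j)%N : uq_rel q e f k kV
    (e i * e j) (e j * e i)
| uq_serre0_f (i j : 'I_n) of (i.+1 < j)%N : uq_rel q e f k kV
    (f i * f j) (f j * f i)
| uq_serre1_e (i j : 'I_n) of (i.+1 < n)%N & i.+1 = j \/ j.+1 = i :
    uq_rel q e f k kV
      (e i ^+ 2 * e j - (q + q^-1) *: (e i * e j * e i) + e j * e i ^+ 2) 0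
| uq_serre1_f (i j : 'I_n) of (i.+1 < n)%N & i.+1 = j \/ j.+1 = i :
    uq_rel q e f k kV
      (f i ^+ 2 * f j - (q + q^-1) *: (f i * f j * f i) + f j * f i ^+ 2) 0
| uq_serre2_e (i j : 'I_n) of i.+1 = n & j.+1 = i : uq_rel q e f k kV
    (e i ^+ 3 * e j - (q + 1 + q^-1) *: (e i ^+ 2 * e j * e i)
     + (q + 1 + q^-1) *: (e i * e j * e i ^+ 2) - e j * e i ^+ 3) 0
| uq_serre2_f (i j : 'I_n) of i.+1 = n & j.+1 = i : uq_rel q e f k kV
    (f i ^+ 3 * f j - (q + 1 + q^-1) *: (f i ^+ 2 * f j * f i)
     + (q + 1 + q^-1) *: (f i * f j * f i ^+ 2) - f j * f i ^+ 3) 0.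

Lemma uq_rel_morph (K : fieldType) (A B : algType K) n (q : K)
    (e f k kV : 'I_n -> A) (e' f' k' kV' : 'I_n -> B)
    (phi : {lrmorphism A -> B}) :
  (forall i, phi (e i) = e' i) -> (forall i, phi (f i) = f' i) ->
  (forall i, phi (k i) = k' i) -> (forall i, phi (kV i) = kV' i) ->
  forall x y, uq_rel q e f k kV x y -> uq_rel q e' f' k' kV' (phi x) (phi y).
Proof.
move=> ee ff kk kkV x y.
case=> *; rewrite ?(fun_if phi) ?(rmorphB, rmorphD, rmorph0) /= ?linearZ /=
  ?(rmorphB, rmorphM, rmorph1, rmorph0) /= ?(ee, ff, kk, kkV) ?scalerN;
  first [by constructor | exact: uq_serre1_e | exact: uq_serre1_f
        | exact: uq_serre2_e | exact: uq_serre2_f].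
Qed.

Inductive uq_gen n : Type :=
  GenE of 'I_n | GenF of 'I_n | GenK of 'I_n | GenKV of 'I_n.

HB.instance Definition _ n := gen_eqMixin (uq_gen n).
HB.instance Definition _ n := gen_choiceMixin (uq_gen n).

Definition uq_free_rel (K : fieldType) n (q : K) :
    freealg K (uq_gen n) -> freealg K (uq_gen n) -> Prop :=
  uq_rel q (fun i => fgen K (GenE i)) (fun i => fgen K (GenF i))
    (fun i => fgen K (GenK i)) (fun i => fgen K (GenKV i)).

Section UqEval.
Context (K : fieldType) (n : nat) (q : K) (S : algType K).
Context (e f k kV : 'I_n -> S).

Definition uq_gen_eval (g : uq_gen n) : S :=
  match g with
  | GenE i => e i | GenF i => f i | GenK i => k i | GenKV i => kV i
  end.

Lemma uq_free_eval :
    (forall x y, uq_rel q e f k kV x y -> x = y) ->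
  forall x y, uq_free_rel q x y ->
    free_eval uq_gen_eval x = free_eval uq_gen_eval y.
Proof.
move=> relS x y xy; apply: relS; move: xy.
by apply: uq_rel_morph => i /=; rewrite free_eval_gen.
Qed.

End UqEval.

(* The augmentation e_i, f_i |-> 0, q^(h_i) |-> 1.                            *)
Lemma uq_counit_rel (K : fieldType) n (q : K) (x y : K^o) :
  uq_rel (A := K^o) q (fun _ : 'I_n => 0) (fun=> 0) (fun=> 1) (fun=> 1) x y ->
  x = y.
Proof.
by case=> *; rewrite ?exprS ?(mul0r, mulr0, mul1r, scaler0, subrr, addr0) //;
  case: ifP => // _; rewrite scaler0.
Qed.

Lemma uq_proper (K : fieldType) n (q : K) :
  1 \notin in_rel_ideal (@uq_free_rel K n q).
Proof.
apply/negP => /(rel_ideal_morph (uq_free_eval (@uq_counit_rel K n q)))/eqP.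
by rewrite rmorph1 oner_eq0.
Qed.

Definition Uq (K : fieldType) n (q : K) : algType K :=
  quot_alg (uq_proper n q).

Section UqElements.
Context (K : fieldType) (n : nat) (q : K).
Implicit Types i : 'I_n.

Definition uq_pi : freealg K (uq_gen n) -> Uq n q := @quot_pi K _ _ _.

Definition Ue i : Uq n q := uq_pi (fgen K (GenE i)).
Definition Uf i : Uq n q := uq_pi (fgen K (GenF i)).
Definition Uk i : Uq n q := uq_pi (fgen K (GenK i)).
Definition UkV i : Uq n q := uq_pi (fgen K (GenKV i)).

End UqElements.

(* On the 0-based indices of K^N, N = 2n+1, the involution i |-> i' = N + 1 - *)
(* i is rev_ord.                                                              *)

Section NaturalRep.
Context (K : fieldType) (n : nat).
Local Notation N := n.*2.+1.
Implicit Types (i : 'I_n) (j : 'I_N).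

Definition vidx (a : nat) : 'I_N := inord a.
Definition vidx' (a : nat) : 'I_N := rev_ord (vidx a).

Definition nat_e i : 'M[K]_N :=
  delta_mx (vidx i) (vidx i.+1) - delta_mx (vidx' i.+1) (vidx' i).

Definition nat_f i : 'M[K]_N :=
  delta_mx (vidx i.+1) (vidx i) - delta_mx (vidx' i) (vidx' i.+1).

Definition nat_wt i j : int :=
  if (i.+1 < n)%N then
    (j == vidx i)%:R - (j == vidx' i)%:R
    - (j == vidx i.+1)%:R + (j == vidx' i.+1)%:R
  else (j == vidx i)%:R - (j == vidx' i)%:R.

Definition nat_k (q : K) i : 'M[K]_N := diag_mx (\row_j q ^ nat_wt i j).
Definition nat_kV (q : K) i : 'M[K]_N := diag_mx (\row_j q ^ (- nat_wt i j)).

Lemma vidxE a : (a < N)%N -> vidx a = a :> nat.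
Proof. by move=> ?; rewrite inordK. Qed.

Lemma vidx'E a : (a < N)%N -> vidx' a = (n.*2 - a)%N :> nat.
Proof. by move=> ?; rewrite /= inordK // subSS. Qed.

Let D (a b : nat) : 'M[K]_N := delta_mx (vidx a) (vidx b).

Lemma vidx'_vidx a : (a < N)%N -> vidx' a = vidx (n.*2 - a).
Proof. by move=> aN; apply: val_inj; rewrite /= !inordK //; lia. Qed.

Lemma DD a b c d : (b < N)%N -> (c < N)%N ->
  D a b *m D c d = if b == c then D a d else 0.
Proof.
move=> bN cN; rewrite /D mul_delta_mx_cond -(inj_eq val_inj) /= !inordK //.
by case: eqP.
Qed.

Lemma nat_eD i : nat_e i = D i i.+1 - D (n.*2 - i.+1) (n.*2 - i).
Proof. by rewrite /nat_e !vidx'_vidx //; have := ltn_ord i; lia. Qed.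

Lemma nat_e_tr i : nat_f i = (nat_e i)^T.
Proof. by rewrite /nat_f /nat_e linearB /= !trmx_delta. Qed.

Lemma nat_wtE i j : nat_wt i j =
  ((j == i :> nat)%:R - (j == n.*2 - i :> nat)%N%:R
    - (j == i.+1 :> nat)%:R + (j == n.*2 - i.+1 :> nat)%N%:R)%R.
Proof.
have ? := ltn_ord i; have ? := ltn_ord j.
have ordE (x y : 'I_N) : (x == y) = (x == y :> nat) by [].
rewrite /nat_wt !ordE !vidxE ?vidx'E; try lia.
by case: ifP; lia.
Qed.

Lemma root_formE (i i' : 'I_n) : root_form i i' =
  (i == i' :> nat)%:R - (i == i'.+1 :> nat)%:R
  - (i.+1 == i' :> nat)%:R + ((i == i' :> nat) && (i.+1 < n)%N)%:R.
Proof.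
rewrite /root_form (bigD1 i) //= /eps_coord eqxx.
have [in1|in1] := boolP (i.+1 < n)%N.
  rewrite (bigD1 (Ordinal in1)) /=; last by rewrite -(inj_eq val_inj) /=; lia.
  rewrite big1 => [|j /andP[ji ji1]].
    rewrite -!(inj_eq val_inj) /=; lia.
  rewrite (negbTE ji); move: ji1; rewrite -(inj_eq val_inj) /= => /negbTE ->.
  by rewrite mul0r.
rewrite big1 => [|j ji].
  rewrite -!(inj_eq val_inj) /=; have := ltn_ord i'; lia.
have -> : (j == i.+1 :> nat) = false by have := ltn_ord j; lia.
by rewrite (negbTE ji) mul0r.
Qed.

Lemma diag_conj (u v : 'rV[K]_N) a b : (a < N)%N -> (b < N)%N ->
  diag_mx u *m D a b *m diag_mx v = (u 0 (vidx a) * v 0 (vidx b)) *: D a b.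
Proof.
move=> aN bN; apply/matrixP => x y.
rewrite mul_mx_diag mul_diag_mx !mxE.
case: (x =P vidx a) => [->|_] /=; last by rewrite !(mulr0, mul0r).
case: (y =P vidx b) => [->|_] /=; last by rewrite !(mulr0, mul0r).
by rewrite !mulr1.
Qed.

Lemma nat_wt_low i a : (a <= n)%N -> nat_wt i (vidx a) =
  (a == i)%:R - (a == i.+1)%:R + ((a == n) && (i.+1 == n))%:R.
Proof.
move=> an; have ? := ltn_ord i; rewrite nat_wtE vidxE; last by lia.
have -> : (a == n.*2 - i)%N = false by lia.
have -> : (a == n.*2 - i.+1)%N = ((a == n) && (i.+1 == n)) by lia.
by rewrite subr0.
Qed.

Lemma nat_wt_opp i a : (a < N)%N ->
  nat_wt i (vidx (n.*2 - a)) = - nat_wt i (vidx a).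
Proof.
move=> aN; have ? := ltn_ord i; have a'N : (n.*2 - a < N)%N by lia.
rewrite !nat_wtE (vidxE aN) (vidxE a'N).
have -> : (n.*2 - a == i)%N = (a == n.*2 - i)%N by lia.
have -> : (n.*2 - a == n.*2 - i)%N = (a == i)%N by lia.
have -> : (n.*2 - a == i.+1)%N = (a == n.*2 - i.+1)%N by lia.
have -> : (n.*2 - a == n.*2 - i.+1)%N = (a == i.+1)%N by lia.
ring.
Qed.

Lemma root_form_wt (i i' : 'I_n) :
  root_form i i' = nat_wt i (vidx i') - nat_wt i (vidx i'.+1).
Proof.
have ? := ltn_ord i; have ? := ltn_ord i'.
rewrite root_formE !nat_wt_low; try lia.
Qed.

Lemma nat_ke (q : K) i i' : q != 0 ->
  nat_k q i *m nat_e i' *m nat_kV q i = q ^ root_form i i' *: nat_e i'.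
Proof.
move=> q0; have ? := ltn_ord i; have ? := ltn_ord i'.
rewrite nat_eD mulmxBr mulmxBl !diag_conj ?scalerBr; try lia.
rewrite !mxE -!expfzDr // !nat_wt_opp; try lia.
by congr (q ^ _ *: _ - q ^ _ *: _); rewrite root_form_wt // opprK addrC.
Qed.

Lemma nat_k_tr (q : K) i : (nat_k q i)^T = nat_k q i.
Proof. exact: tr_diag_mx. Qed.
Lemma nat_kV_tr (q : K) i : (nat_kV q i)^T = nat_kV q i.
Proof. exact: tr_diag_mx. Qed.

Lemma nat_kkV (q : K) i : q != 0 -> nat_k q i *m nat_kV q i = 1%:M.
Proof.
move=> q0; rewrite mulmx_diag -diag_const_mx; congr diag_mx.
by apply/rowP => j; rewrite !mxE -expfzDr // subrr.
Qed.

Lemma nat_e_sqE i :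
  nat_e i *m nat_e i = if i.+1 == n then - D i (n.*2 - i) else 0.
Proof.
have ? := ltn_ord i; rewrite nat_eD mulmxBl !mulmxBr !DD; try lia.
have -> : (i.+1 == i) = false by lia.
have -> : (i.+1 == n.*2 - i.+1)%N = (i.+1 == n) by lia.
have -> : (n.*2 - i == i)%N = false by lia.
have -> : (n.*2 - i == n.*2 - i.+1)%N = false by lia.
by case: eqP => _; rewrite ?subrr ?sub0r ?subr0 ?oppr0.
Qed.

Lemma nat_e_sq i : (i.+1 < n)%N -> nat_e i *m nat_e i = 0.
Proof. by rewrite nat_e_sqE; case: eqP => // ->; rewrite ltnn. Qed.

Lemma nat_e_cube i : nat_e i *m nat_e i *m nat_e i = 0.
Proof.
have ? := ltn_ord i; rewrite nat_e_sqE; case: eqP => [_|]; rewrite ?mul0mx //.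
rewrite nat_eD mulNmx mulmxBr !DD; try lia.
have -> : (n.*2 - i == i)%N = false by lia.
have -> : (n.*2 - i == n.*2 - i.+1)%N = false by lia.
by rewrite subrr oppr0.
Qed.

Lemma nat_ee i i' : i != i' -> nat_e i *m nat_e i' =
  (if i.+1 == i' then D i i'.+1 else 0)
  + (if i == i'.+1 :> nat then D (n.*2 - i.+1) (n.*2 - i') else 0).
Proof.
rewrite -(inj_eq val_inj) /= => ii'; have ? := ltn_ord i; have ? := ltn_ord i'.
rewrite !nat_eD mulmxBl !mulmxBr !DD; try lia.
have -> : (i.+1 == n.*2 - i'.+1)%N = false by lia.
have -> : (n.*2 - i == i')%N = false by lia.
have -> : (n.*2 - i == n.*2 - i'.+1)%N = (i == i'.+1 :> nat) by lia.
by rewrite subr0 sub0r opprK.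
Qed.

Lemma nat_eee i i' : i != i' -> nat_e i *m nat_e i' *m nat_e i = 0.
Proof.
move=> ii'; rewrite nat_ee //; move: ii'; rewrite -(inj_eq val_inj) /= => ii'.
have ? := ltn_ord i; have ? := ltn_ord i'; rewrite nat_eD mulmxDl.
case: (i.+1 =P i') => [ii1|_]; case: (i =P i'.+1 :> nat) => [i1i|_]; try lia.
- rewrite mul0mx addr0 mulmxBr !DD; try lia.
  have -> : (i'.+1 == i) = false by lia.
  have -> : (i'.+1 == n.*2 - i.+1)%N = false by lia.
  by rewrite subrr.
- rewrite mul0mx add0r mulmxBr !DD; try lia.
  have -> : (n.*2 - i' == i)%N = false by lia.
  have -> : (n.*2 - i' == n.*2 - i.+1)%N = false by lia.
  by rewrite subrr.
- by rewrite !mul0mx addr0.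
Qed.

Lemma nat_e_comm i i' : (i.+1 < i')%N ->
  nat_e i *m nat_e i' = nat_e i' *m nat_e i.
Proof.
move=> ii'; have neq : i != i' by rewrite -(inj_eq val_inj) /=; lia.
have neq' : i' != i by rewrite eq_sym.
rewrite !nat_ee //.
have -> : (i.+1 == i') = false by lia.
have -> : (i == i'.+1 :> nat) = false by lia.
have -> : (i'.+1 == i) = false by lia.
by have -> : (i' == i.+1 :> nat) = false by lia.
Qed.

Lemma nat_fD i : nat_f i = D i.+1 i - D (n.*2 - i) (n.*2 - i.+1).
Proof. by rewrite /nat_f !vidx'_vidx //; have := ltn_ord i; lia. Qed.

Lemma nat_ef_neq i i' : i != i' ->
  nat_e i *m nat_f i' - nat_f i' *m nat_e i = 0.
Proof.
rewrite -(inj_eq val_inj) /= => ii'; have ? := ltn_ord i; have ? := ltn_ord i'.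
rewrite nat_eD nat_fD !(mulmxBl, mulmxBr) !DD; try lia.
have -> : (i.+1 == i'.+1) = false by lia.
have -> : (i.+1 == n.*2 - i')%N = false by lia.
have -> : (n.*2 - i == i'.+1)%N = false by lia.
have -> : (n.*2 - i == n.*2 - i')%N = false by lia.
have -> : (i' == i :> nat) = false by lia.
have -> : (i' == n.*2 - i.+1 :> nat)%N = false by lia.
have -> : (n.*2 - i'.+1 == i :> nat)%N = false by lia.
have -> : (n.*2 - i'.+1 == n.*2 - i.+1)%N = false by lia.
by rewrite !subrr.
Qed.

Lemma qint_small (q : K) (w : int) : q - q^-1 != 0 -> `|w| <= 1 ->
  (q - q^-1)^-1 * (q ^ w - q ^ (- w)) = w%:~R.
Proof.
move=> q1 w1.
have [->|[->|->]] : w = 0 \/ w = 1 \/ w = -1 by lia.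
- by rewrite oppr0 subrr mulr0.
- by rewrite exprN1 expr1z mulVf.
- by rewrite exprN1 opprK expr1z -[X in _ * X]opprB mulrN mulVf // mulrNz.
Qed.

Lemma nat_ef (q : K) i : q - q^-1 != 0 ->
  nat_e i *m nat_f i - nat_f i *m nat_e i =
  (q - q^-1)^-1 *: (nat_k q i - nat_kV q i).
Proof.
move=> q1; have ? := ltn_ord i.
rewrite nat_eD nat_fD !(mulmxBl, mulmxBr) !DD; try lia.
rewrite !eqxx.
have -> : (i.+1 == n.*2 - i)%N = false by lia.
have -> : (n.*2 - i == i.+1)%N = false by lia.
have -> : (i == n.*2 - i.+1 :> nat)%N = false by lia.
have -> : (n.*2 - i.+1 == i :> nat)%N = false by lia.
apply/matrixP => x y; rewrite !mxE.
have [->|xy] := eqVneq x y; last first.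
  rewrite !mulr0n subrr mulr0.
  have xE a : (x == vidx a) && (y == vidx a) = false.
    by apply/negP => /andP[/eqP xa /eqP ya]; rewrite xa ya eqxx in xy.
  by rewrite !xE !(subrr, oppr0, addr0, subr0).
rewrite !mulr1n qint_small // ?nat_wtE.
  rewrite !andbb -!(inj_eq val_inj) /= !inordK; try lia.
  rewrite !(rmorphD, rmorphB, rmorphN) /= !mulrz_nat.
  ring.
have ? := ltn_ord y; lia.
Qed.

Lemma nat_rel (q : K) : q != 0 -> q - q^-1 != 0 ->
  forall x y, uq_rel q nat_e nat_f (nat_k q) (nat_kV q) x y -> x = y.
Proof.
move=> q0 q1 x y.
have ke i i' :
    nat_k q i * nat_e i' * nat_kV q i = q ^ root_form i i' *: nat_e i'.
  exact: nat_ke.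
have kkV i : nat_k q i * nat_kV q i = 1 by apply: nat_kkV.
have diagC (u v : 'rV[K]_N) : diag_mx u * diag_mx v = diag_mx v * diag_mx u.
  rewrite /GRing.mul /= !mulmx_diag; congr diag_mx.
  by apply/rowP => j; rewrite !mxE mulrC.
have kVk i : nat_kV q i * nat_k q i = 1 by rewrite [LHS]diagC; apply: kkV.
have sq0 i : (i.+1 < n)%N -> nat_e i ^+ 2 = 0 by apply: nat_e_sq.
have cube0 i : nat_e i ^+ 3 = 0 by rewrite exprS expr2 mulrA; apply: nat_e_cube.
have aba0 i i' : i != i' -> nat_e i * nat_e i' * nat_e i = 0 by apply: nat_eee.
have comm i i' : (i.+1 < i')%N -> nat_e i * nat_e i' = nat_e i' * nat_e i.
  exact: nat_e_comm.
have trM (u v : 'M[K]_N) : u^T * v^T = (v * u)^T by rewrite trmx_mul.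
have trX (u : 'M[K]_N) l : u^T ^+ l = (u ^+ l)^T.
  by elim: l => [|l IH]; rewrite ?trmx1 // exprS IH trM -exprSr.
have adj (i i' : 'I_n) : i.+1 = i' \/ i'.+1 = i -> i != i'.
  by rewrite -(inj_eq val_inj) /=; lia.
case.
- exact: kkV.
- exact: kVk.
- by move=> i i'; apply: diagC.
- exact: ke.
- move=> i i'; rewrite !nat_e_tr.
  have kfE :
      nat_kV q i * nat_e i' * nat_k q i = q ^ (- root_form i i') *: nat_e i'.
    apply: (@scalerI _ _ (q ^ root_form i i')); first by rewrite expfz_neq0.
    rewrite scalerA -expfzDr // subrr scale1r scalerAl scalerAr -ke.
    by rewrite !mulrA kVk mul1r -mulrA kVk mulr1.
  by rewrite -[nat_k q i]nat_k_tr -[nat_kV q i]nat_kV_tr !trM mulrA kfE linearZ.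
- move=> i i'; case: (eqVneq i i') => [<-|]; [exact: nat_ef|exact: nat_ef_neq].
- exact: comm.
- by move=> i i' ii'; rewrite !nat_e_tr !trM (comm _ _ ii').
- move=> i i' ltin /adj neq; rewrite sq0 // aba0 //.
  by rewrite mul0r mulr0 scaler0 subr0 addr0.
- move=> i i' ltin /adj neq; rewrite !nat_e_tr !trX !trM sq0 // mulrA aba0 //.
  by rewrite mul0r mulr0 trmx0 scaler0 subr0 addr0.
- move=> i i' iN i'i; have neq : i != i' by apply: adj; right.
  have z1 : nat_e i ^+ 2 * nat_e i' * nat_e i = 0.
    by rewrite expr2 -!mulrA [X in _ * X]mulrA aba0 ?mulr0.
  have z2 : nat_e i * nat_e i' * nat_e i ^+ 2 = 0.
    by rewrite expr2 mulrA aba0 ?mul0r.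
  by rewrite z1 z2 cube0 mul0r mulr0 !scaler0 !subr0 addr0.
- move=> i i' iN i'i; have neq : i != i' by apply: adj; right.
  have z1 : nat_e i ^+ 2 * nat_e i' * nat_e i = 0.
    by rewrite expr2 -!mulrA [X in _ * X]mulrA aba0 ?mulr0.
  have z2 : nat_e i * nat_e i' * nat_e i ^+ 2 = 0.
    by rewrite expr2 mulrA aba0 ?mul0r.
  rewrite !nat_e_tr !trX !trM (mulrA (nat_e i)) z2.
  rewrite (mulrA (nat_e i ^+ 2)) z1 cube0.
  by rewrite mul0r mulr0 trmx0 !scaler0 !subr0 addr0.
Qed.

End NaturalRep.

Section NaturalRepMorphism.
Context (K : fieldType) (n : nat) (q : K).
Context (q_neq0 : q != 0) (q_nroot : forall l, (0 < l)%N -> q ^+ l != 1).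

Lemma qsubV_neq0 : q - q^-1 != 0.
Proof.
have := q_nroot (ltn0Sn 1); apply: contraNneq => /subr0_eq qV.
by rewrite expr2 [X in _ * X]qV mulfV.
Qed.

Definition natrep : Uq n q -> 'M[K]_n.*2.+1 :=
  quot_lift (I_proper := uq_proper n q)
    (uq_free_eval (nat_rel q_neq0 qsubV_neq0)).

HB.instance Definition _ := GRing.LRMorphism.on natrep.

Lemma natrep_gen (g : uq_gen n) : natrep (uq_pi q (fgen K g)) =
  uq_gen_eval (@nat_e K n) (@nat_f K n) (nat_k q) (nat_kV q) g.
Proof. by rewrite [LHS]quot_lift_pi; apply: free_eval_gen. Qed.

Lemma natrep_e i : natrep (Ue q i) = nat_e K i.
Proof. exact: natrep_gen. Qed.

Lemma natrep_f i : natrep (Uf q i) = nat_f K i.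
Proof. exact: natrep_gen. Qed.

Lemma natrep_k i : natrep (Uk q i) = nat_k q i.
Proof. exact: natrep_gen. Qed.

Lemma natrep_kV i : natrep (UkV q i) = nat_kV q i.
Proof. exact: natrep_gen. Qed.

End NaturalRepMorphism.

Arguments natrep {K n q} q_neq0 q_nroot x : simpl never.

Inductive gen_subalg (K : fieldType) (B : algType K) (S : B -> Prop) :
    B -> Prop :=
| gen_subalg_in x of S x : gen_subalg S x
| gen_subalg1 : gen_subalg S 1
| gen_subalgZ c x of gen_subalg S x : gen_subalg S (c *: x)
| gen_subalgD x y of gen_subalg S x & gen_subalg S y : gen_subalg S (x + y)
| gen_subalgM x y of gen_subalg S x & gen_subalg S y : gen_subalg S (x * y).

(* [x, y]_a                                                                   *)
Definition qcomm (K : fieldType) (B : algType K) (a : K) (x y : B) : B :=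
  x * y - a *: (y * x).

Section SubalgebraK.
Context (K : fieldType) (n m : nat) (q : K) (y : 'I_n.*2.+1 -> K).
Local Notation N := n.*2.+1.
Implicit Types (i : 'I_n) (b : 'rV[int]_n).

Definition Ukz i (z : int) : Uq n q :=
  match z with Posz l => Uk q i ^+ l | Negz l => UkV q i ^+ l.+1 end.

(* q^(h_beta), for beta = \sum_i b_i alpha_i given by its row of coefficients *)
(* b; likewise for the roots below.                                           *)
Definition Uqh b : Uq n q := \prod_(i < n) Ukz i (b 0 i).

Definition alpha i : 'rV[int]_n := delta_mx 0 i.

(* The sum is empty if m = n.                                                 *)
Definition talpha i : 'rV[int]_n :=
  if i.+1 == m then alpha i + (\sum_(l < n | (i < l)%N) alpha l) *+ 2
  else alpha i.

Definition UF i : Uq n q := Uk q i * Uf q i.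

(* The successors of i in 'I_n, in increasing order.                          *)
Definition ord_above i : seq 'I_n := [seq l : 'I_n <- enum 'I_n | (i < l)%N].

(* For i.+1 = m the two folds bracket with F_(m+1), ..., F_n and then with    *)
(* F_n, ..., F_(m+1); all brackets are q-commutators but the second one with  *)
(* F_n, which is a plain commutator.  Both folds are trivial if m = n.        *)
Definition UtF i : Uq n q :=
  if i.+1 == m then
    foldl (fun x (l : 'I_n) => qcomm (if l.+1 == n then 1 else q) x (UF l))
      (foldl (fun x (l : 'I_n) => qcomm q x (UF l)) (UF i) (ord_above i))
      (rev (ord_above i))
  else UF i.

(* In the last two cases i.+1 = m: for i : 'I_n, this is only used if i < m.  *)
Definition mixture_coef i : K :=
  if (i.+1 < m)%N then - (q * y (vidx n i.+1) / y (vidx n i))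
  else if m == n then - (y (vidx n i) * q ^+ m)^-1
  else (-1) ^+ (n - m).+1 / (y (vidx n i) * q ^+ m.+1).

Definition UX i : Uq n q :=
  Uqh (talpha i - alpha i) * Ue q i + mixture_coef i *: UtF i.

Inductive Uqk_gen : Uq n q -> Prop :=
| Uqk_e i of (m <= i)%N : Uqk_gen (Ue q i)
| Uqk_f i of (m <= i)%N : Uqk_gen (Uf q i)
| Uqk_k i of (m <= i)%N : Uqk_gen (Uk q i)
| Uqk_kV i of (m <= i)%N : Uqk_gen (UkV q i)
| Uqk_X i of (i < m)%N : Uqk_gen (UX i)
| Uqk_h i of (i < m)%N : Uqk_gen (Uqh (talpha i - alpha i))
| Uqk_hV i of (i < m)%N : Uqk_gen (Uqh (- (talpha i - alpha i))).

Definition Uqk : Uq n q -> Prop := gen_subalg Uqk_gen.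

(* The sign is (-1)^s.  In 0-based indices i <= m reads i < m, and m < i < m' *)
(* reads m <= i < N - m.                                                      *)
Definition Amat (s : bool) : 'M[K]_N :=
  (-1) ^+ s *:
    (\sum_(i < N | (i < m)%N)
        (q ^ (- m%:Z) * (1 - q ^ (- N%:Z + m.*2%:Z))) *: delta_mx i i
     + \sum_(i < N | (m <= i < N - m)%N) q ^ (- m%:Z) *: delta_mx i i
     + \sum_(i < N | (i < m)%N || (rev_ord i < m)%N)
         y i *: delta_mx i (rev_ord i)).

End SubalgebraK.

(* Main.v *)
(* Write p for q^-1 and D a b for the matrix units in 0-based indices, so that
   the involution is a |-> 2n - a.  On the middle block of coordinates
   m <= a < N - m the matrix A is the scalar p^m up to sign, and the generators
   with index >= m are supported there, apart from the identity outside the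
   block for the q^(h_i).  Each successive bracket in the definition of
   F_(tilde alpha_m) merely shifts one index in each of the two terms of F_m, so
   that its image is
     (-1)^(n - m) (p D (2n - m) (m - 1) - p^(2(n - m)) D (2n - m + 1) m)
   for m < n.  Hence each X_(alpha_i) maps to a combination of four matrix
   units, and since A D a b and D a b A have at most two terms, commutation
   with A is a comparison of coefficients using y_a y_(2n - a) = q^(-N). *)

Require Import Defs.
From mathcomp Require Import all_boot all_order all_algebra.
From mathcomp Require Import zify ring.
From mathcomp Require Import reals complex.

Import GRing.Theory.
Local Open Scope ring_scope.

(** * Bracket order, root coefficients, weights and sums of matrix units *)

Lemma lrmorph_qcomm (K : fieldType) (B C : algType K)
    (phi : {lrmorphism B -> C}) (a : K) (x y : B) :
  phi (qcomm a x y) = qcomm a (phi x) (phi y).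
Proof. by rewrite /qcomm rmorphB /= linearZ_LR /= !rmorphM. Qed.

(** Turns the bracketing order into an interval of naturals, along which the inductions over
    brackets run. *)
Lemma val_ord_above (n : nat) (i : 'I_n) :
  map val (ord_above i) = iota i.+1 (n - i.+1).
Proof.
rewrite /ord_above -(filter_map (val : 'I_n -> nat) (fun l => i < l)%N).
rewrite val_enum_ord.
have -> : iota 0 n = iota 0 i.+1 ++ iota i.+1 (n - i.+1).
  by rewrite -iotaD subnKC.
rewrite filter_cat -[RHS]cat0s; congr (_ ++ _).
  rewrite (eq_in_filter (a2 := pred0)) ?filter_pred0 // => l.
  by rewrite mem_iota /=; lia.
by apply/all_filterP/allP => l; rewrite mem_iota => /andP[].
Qed.

Lemma talphaB (n m : nat) (i l : 'I_n) : (talpha m i - alpha i) 0 l =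
  if (i.+1 == m) && (i < l)%N then 2 else 0.
Proof.
rewrite /talpha; case: ifP => _ /=; last by rewrite subrr mxE.
rewrite addrAC subrr add0r mulr2n mxE summxE.
under eq_bigr do rewrite /alpha mxE eqxx /=.
have [il|li] := ltnP i l.
  by rewrite (bigD1 l) //= eqxx big1 ?addr0 // => k /andP[_ kl];
    rewrite eq_sym (negbTE kl).
rewrite big1 ?addr0 // => k ik; have -> // : (l == k) = false.
by rewrite -(inj_eq val_inj) /=; lia.
Qed.

(** Weights of consecutive simple roots telescope, and the boundary term at [n] vanishes because the
    involution fixes [n]. For [i.+1 = m], twice this sum is the weight of [talpha m i - alpha i]. *)
Lemma sum_nat_wt (n : nat) (i : 'I_n) (j : 'I_n.*2.+1) :
  \sum_(l < n | (i < l)%N) nat_wt l j =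
  (j == i.+1 :> nat)%:R - (j == n.*2 - i.+1 :> nat)%N%:R.
Proof.
pose g (t : nat) : int := (j == n.*2 - t :> nat)%N%:R - (j == t :> nat)%:R.
under eq_bigr => l _.
  rewrite nat_wtE.
  have -> : (j == l :> nat)%:R - (j == n.*2 - l :> nat)%N%:R
    - (j == l.+1 :> nat)%:R + (j == n.*2 - l.+1 :> nat)%N%:R = g l.+1 - g l.
    by rewrite /g; ring.
  over.
transitivity (\sum_(i.+1 <= l < n) (g l.+1 - g l)).
  by rewrite big_geq_mkord.
rewrite telescope_sumr // /g.
have -> : (n.*2 - n = n)%N by lia.
by rewrite subrr sub0r opprB.
Qed.

(** All three sums in [Amat] have this shape, with [g] the identity or [rev_ord]. *)
Lemma delta_mul_sum (K : fieldType) (N : nat) (P : pred 'I_N) (c : 'I_N -> K)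
    (g : 'I_N -> 'I_N) (u v : 'I_N) :
  delta_mx u v *m (\sum_(z | P z) c z *: delta_mx z (g z) : 'M[K]_N) =
  if P v then c v *: delta_mx u (g v) else 0.
Proof.
rewrite mulmx_sumr big_mkcond (bigD1 v) //= big1 ?addr0 => [|z zv].
  by case: ifP => // _; rewrite -scalemxAr mul_delta_mx.
by case: ifP => // _; rewrite -scalemxAr mul_delta_mx_0 ?scaler0 // eq_sym.
Qed.

Lemma sum_mul_delta (K : fieldType) (N : nat) (P : pred 'I_N) (c : 'I_N -> K)
    (g : 'I_N -> 'I_N) (u v : 'I_N) : involutive g ->
  (\sum_(z | P z) c z *: delta_mx z (g z) : 'M[K]_N) *m delta_mx u v =
  if P (g u) then c (g u) *: delta_mx (g u) v else 0.
Proof.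
move=> gK; rewrite mulmx_suml big_mkcond (bigD1 (g u)) //=.
rewrite big1 ?addr0 => [|z zgu].
  by case: ifP => // _; rewrite -scalemxAl gK mul_delta_mx.
case: ifP => // _; rewrite -scalemxAl mul_delta_mx_0 ?scaler0 //.
by apply: contraNneq zgu => <-; rewrite gK.
Qed.

(** * Images of root vectors and Cartan elements in the natural representation *)

Section Stabilizer.
Variables (K : fieldType) (n : nat) (q : K).
Hypotheses (q_neq0 : q != 0)
  (q_nroot : forall l : nat, (0 < l)%N -> q ^+ l != 1).
Local Notation N := n.*2.+1.
Local Notation D a b := (delta_mx (vidx n a) (vidx n b) : 'M[K]_N).
Local Notation rho := (natrep q_neq0 q_nroot).
Implicit Types (i l : 'I_n).

Let p : K := q^-1.

Let qp : q * p = 1. Proof. exact: mulfV. Qed.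

Let exprN_p (k : nat) : q ^ (- k%:Z) = p ^+ k.
Proof. by rewrite -exprnN exprVn. Qed.

Lemma delta_vidx_mul a b c d : (b < N)%N -> (c < N)%N ->
  D a b *m D c d = (b == c)%:R *: D a d.
Proof. by move=> bN cN; rewrite DD //; case: eqP; rewrite ?scale1r ?scale0r. Qed.

Lemma diag_delta_vidx (w : 'rV[K]_N) a b :
  diag_mx w *m D a b = w 0 (vidx n a) *: D a b.
Proof.
apply/matrixP => x z; rewrite mul_diag_mx !mxE.
by case: (x =P vidx n a) => [->|]; rewrite ?mulr0.
Qed.

Lemma natrep_qcomm (a : K) (x y : Uq n q) :
  rho (qcomm a x y) = rho x *m rho y - a *: (rho y *m rho x).
Proof. exact: lrmorph_qcomm. Qed.

(** The first coefficient is [q] to the weight of [alpha i] at index [i.+1]: this weight is -1,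
    except that it is 0 at the central index [n]. *)
Lemma natrep_UF i : rho (UF q i) =
  (if i.+1 == n then 1 else p) *: D i.+1 i
  - p *: D (n.*2 - i) (n.*2 - i.+1).
Proof.
have i_lt := ltn_ord i.
rewrite /UF rmorphM /= natrep_k natrep_f nat_fD.
rewrite -[LHS]/(nat_k q i *m _) mulmxBr !diag_delta_vidx !mxE.
rewrite nat_wt_opp; last by lia.
rewrite !nat_wt_low; try lia.
have -> : (i == i.+1 :> nat) = false by lia.
have -> : (i.+1 == i :> nat) = false by lia.
have -> : (i == n :> nat) = false by lia.
rewrite !eqxx andbb; congr (_ *: _ - _ *: _).
by case: ifP.
Qed.

(** Here [x] is the bracket built up to index [j - 1]. In the next bracket the factor [q] cancels
    the [p] already on the first term, which thus always carries the coefficient of the latest F;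
    the second term gains one [p] each time. *)
Lemma natrep_foldl_up i (s : seq 'I_n) j x :
    map val s = iota j (size s) -> (i < j)%N -> (j + size s <= n)%N ->
    rho x = (-1) ^+ (j - i.+1) *:
      ((if j == n then 1 else p) *: D j i
       - p ^+ (j - i) *: D (n.*2 - i) (n.*2 - j)) ->
  rho (foldl (fun x l => qcomm q x (UF q l)) x s) =
    (-1) ^+ (j + size s - i.+1) *:
      ((if (j + size s)%N == n then 1 else p) *: D (j + size s)%N i
       - p ^+ (j + size s - i) *: D (n.*2 - i)%N (n.*2 - (j + size s))%N).
Proof.
elim: s j x => [|l s IH] j x /=; first by rewrite !addn0.
case=> lj sj ij jn rx; rewrite -addSnnS; apply: IH => //; try lia.
rewrite natrep_qcomm natrep_UF rx lj -!scalemxAl -!scalemxAr.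
rewrite !mulmxBl !mulmxBr -!scalemxAl -!scalemxAr.
rewrite !delta_vidx_mul; try lia.
(* Of the eight products of matrix units only two survive, one from each order of multiplication. *)
have -> : (i == j.+1 :> nat) = false by lia.
have -> : (i == n.*2 - j :> nat)%N = false by lia.
have -> : (n.*2 - j == j.+1 :> nat)%N = false by lia.
have -> : (j == n.*2 - i :> nat)%N = false by lia.
have -> : (n.*2 - j.+1 == j :> nat)%N = false by lia.
have -> : (n.*2 - j.+1 == n.*2 - i :> nat)%N = false by lia.
have -> : (j == n) = false by lia.
rewrite !eqxx.
have -> : (j.+1 - i = (j - i).+1)%N by lia.
have -> : (j.+1 - i.+1 = (j - i.+1).+1)%N by lia.
apply/matrixP => u v; rewrite !mxE !exprS.
by case: ifP => _ /=; rewrite mulr0n mulr1n; ring: qp.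
Qed.

(** The plain commutator at the top index puts one [p] on the first term; in each later q-commutator
    [q] cancels the new [p]. The second term gains a [p] in every bracket but the first. *)
Lemma natrep_foldl_down i (s : seq 'I_n) j x (a b : K) :
    map val s = iota j (size s) -> (i < j)%N -> (j + size s)%N = n ->
    rho x = a *: D n i - b *: D (n.*2 - i) n ->
  rho (foldl (fun x l => qcomm (if l.+1 == n then 1 else q) x (UF q l)) x
        (rev s)) =
    (if j == n then a else p * a) *: D (n.*2 - j) i
    - ((if j == n then b else q * p ^+ (n - j) * b) *: D (n.*2 - i) j).
Proof.
(* As a right fold over [s], the head is the smallest index, whose bracket is applied last. *)
rewrite foldl_rev => sj; elim: s j sj => [|l s IH] j /=.
  move=> _ _; rewrite addn0 => -> ->; rewrite eqxx.
  by have -> : (n.*2 - n = n)%N by lia.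
case=> lj sj ij jn rx; rewrite natrep_qcomm natrep_UF lj (IH j.+1) //; try lia.
rewrite !mulmxBl !mulmxBr -!scalemxAl -!scalemxAr.
rewrite !delta_vidx_mul; try lia.
have -> : (i == j.+1 :> nat) = false by lia.
have -> : (i == n.*2 - j :> nat)%N = false by lia.
have -> : (j.+1 == n.*2 - j :> nat)%N = false by lia.
have -> : (j == n.*2 - i :> nat)%N = false by lia.
have -> : (j == n.*2 - j.+1 :> nat)%N = false by lia.
have -> : (n.*2 - j.+1 == n.*2 - i :> nat)%N = false by lia.
have -> : (j == n) = false by lia.
rewrite !eqxx.
have -> : (n - j = (n - j.+1).+1)%N by lia.
apply/matrixP => u v; rewrite !mxE !exprS.
have [->|_] := eqVneq j.+1 n.
  by rewrite subnn expr0 /= mulr0n mulr1n; ring: qp.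
by rewrite /= mulr0n mulr1n; ring: qp.
Qed.

Lemma natrep_UtF m i : i.+1 = m -> (m < n)%N ->
  rho (UtF m q i) = (-1) ^+ (n - m) *:
    (p *: D (n.*2 - m) i - p ^+ (n - m).*2 *: D (n.*2 - i) m).
Proof.
move=> im mn; have sz := congr1 size (val_ord_above n i).
rewrite size_map size_iota in sz.
rewrite /UtF im eqxx.
(* The two coefficients are those reached by the upward fold at index [n]. *)
rewrite (natrep_foldl_down i _ m _ ((-1) ^+ (n - m))
  ((-1) ^+ (n - m) * p ^+ (n - i))).
- have -> : (m == n) = false by lia.
  have -> : (n - m).*2 = (n - m + (n - m))%N by rewrite addnn.
  have -> : (n - i = (n - m).+1)%N by lia.
  apply/matrixP => u v; rewrite !mxE exprS exprD.
  by ring: qp.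
- by rewrite val_ord_above sz im.
- by lia.
- by rewrite sz im; lia.
rewrite (natrep_foldl_up i _ m); first last.
- rewrite natrep_UF im; have -> : (m == n) = false by lia.
  have -> : (m - i = 1)%N by lia.
  by rewrite subnn expr0 scale1r expr1.
- by rewrite sz im; lia.
- by lia.
- by rewrite val_ord_above sz im.
rewrite sz im subnKC; last by lia.
have -> : (n.*2 - n = n)%N by lia.
by rewrite eqxx scale1r scalerBr scalerA.
Qed.

Lemma natrep_Ukz i (z : int) :
  rho (Ukz q i z) = diag_mx (\row_j q ^ (z * nat_wt i j)).
Proof.
have diagX (u : 'rV[K]_N) (k : nat) :
    (diag_mx u : 'M[K]_N) ^+ k = diag_mx (\row_j (u 0 j) ^+ k).
  elim: k => [|k IH].
    rewrite expr0 -[LHS]/(1%:M) -diag_const_mx; congr diag_mx.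
    by apply/rowP => j; rewrite !mxE expr0.
  rewrite exprS IH -[LHS]/(_ *m _) mulmx_diag; congr diag_mx.
  by apply/rowP => j; rewrite !mxE exprS.
case: z => k; rewrite /Ukz rmorphXn /= ?natrep_k ?natrep_kV diagX;
  congr diag_mx; apply/rowP => j; rewrite !mxE.
  by rewrite mulrC -exprz_exp.
by rewrite NegzE mulNr mulrC -mulNr -exprz_exp.
Qed.

Lemma natrep_Uqh (b : 'rV[int]_n) :
  rho (Uqh q b) = diag_mx (\row_j q ^ (\sum_(i < n) b 0 i * nat_wt i j)).
Proof.
rewrite /Uqh rmorph_prod /=.
under eq_bigr do rewrite natrep_Ukz.
(* With [P], the product and the sum in the exponent share one index list, open to a single
   induction. *)
pose P (M : 'M[K]_N) (w : 'I_N -> int) := M = diag_mx (\row_j q ^ w j).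
suff : P (\prod_(i < n) diag_mx (\row_j q ^ (b 0 i * nat_wt i j)))
  (fun j => \sum_(i < n) b 0 i * nat_wt i j) by [].
elim: (index_enum _) => [|l r IH].
  rewrite /P big_nil -[LHS]/(1%:M) -diag_const_mx; congr diag_mx.
  by apply/rowP => j; rewrite !mxE big_nil.
rewrite /P big_cons IH -[LHS]/(_ *m _) mulmx_diag; congr diag_mx.
by apply/rowP => j; rewrite !mxE big_cons expfzDr.
Qed.

(** * The matrix A and its products with matrix units *)

Variables (m : nat) (y : 'I_N -> K).
Hypotheses (le_mn : (m <= n)%N)
  (y_inv : forall z : 'I_N, (z < m)%N || (rev_ord z < m)%N ->
     y z * y (rev_ord z) = q ^ (- (n.*2.+1)%:Z)).

Local Notation B := (Amat m q y false).
Local Notation yv a := (y (vidx n a)).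

(** The diagonal entry of A at indices below [m], written like [qN] in [p], [p ^+ m] and
    [p ^+ (n - m)], so that commutation becomes a polynomial identity in these quantities. *)
Let dlow : K := p ^+ m * (1 - (p ^+ (n - m)) ^+ 2 * p).

Let qN : q ^ (- (n.*2.+1)%:Z) = (p ^+ m) ^+ 2 * (p ^+ (n - m)) ^+ 2 * p.
Proof.
rewrite exprN_p -!exprM -exprD -exprSr; congr (_ ^+ _); lia.
Qed.

Let dlowE : q ^ (- m%:Z) * (1 - q ^ (- (N%:Z) + m.*2%:Z)) = dlow.
Proof.
have -> : - N%:Z + m.*2%:Z = - (n - m).*2.+1%:Z by lia.
rewrite !exprN_p /dlow -exprM -exprSr; congr (_ * (1 - _ ^+ _)); lia.
Qed.

Lemma y_inv_vidx a : (a < m)%N ->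
  yv a * yv (n.*2 - a) = (p ^+ m) ^+ 2 * (p ^+ (n - m)) ^+ 2 * p.
Proof.
move=> am; rewrite -qN -(y_inv (vidx n a)); last by rewrite vidxE; lia.
by rewrite -vidx'_vidx //; lia.
Qed.

Lemma y_neq0 a : (a < m)%N -> yv a != 0.
Proof.
move=> am; have := y_inv_vidx a am; apply: contra_eq_neq => ->.
by rewrite mul0r eq_sym !mulf_neq0 ?expf_neq0 // invr_neq0.
Qed.

Lemma y_rev a : (a < m)%N ->
  yv (n.*2 - a) = (p ^+ m) ^+ 2 * (p ^+ (n - m)) ^+ 2 * p / yv a.
Proof.
by move=> am; apply: canRL (mulfK (y_neq0 a am)) _; rewrite mulrC y_inv_vidx.
Qed.

Lemma delta_Amat a b : (b < N)%N -> D a b *m B =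
  (if (b < m)%N then dlow else if (b < N - m)%N then p ^+ m else 0) *: D a b
  + (if (b < m)%N || (n.*2 - b < m)%N then yv b else 0) *: D a (n.*2 - b).
Proof.
move=> bN; rewrite /Amat expr0 scale1r !mulmxDr.
rewrite !(delta_mul_sum _ _ _ _ id) delta_mul_sum dlowE exprN_p.
rewrite -[rev_ord (vidx n b)]/(vidx' n b) vidx'_vidx // !vidxE //; try lia.
have [bm|mb] := ltnP b m.
  by rewrite addr0.
rewrite add0r /=; by do 2!case: ifP => _; rewrite ?scale0r.
Qed.

Lemma Amat_delta a b : (a < N)%N -> B *m D a b =
  (if (a < m)%N then dlow else if (a < N - m)%N then p ^+ m else 0) *: D a b
  + (if (a < m)%N || (n.*2 - a < m)%N then yv (n.*2 - a) else 0)
      *: D (n.*2 - a) b.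
Proof.
move=> aN; rewrite /Amat expr0 scale1r !mulmxDl.
rewrite !(sum_mul_delta _ _ _ _ id) // sum_mul_delta; last exact: rev_ordK.
rewrite rev_ordK dlowE exprN_p.
rewrite -[rev_ord (vidx n a)]/(vidx' n a) vidx'_vidx // !vidxE //; try lia.
rewrite orbC; have [am|ma] := ltnP a m.
  by rewrite addr0.
rewrite add0r /=; by do 2!case: ifP => _; rewrite ?scale0r.
Qed.

Lemma delta_Amat_low a b : (b < m)%N ->
  D a b *m B = dlow *: D a b + yv b *: D a (n.*2 - b).
Proof. by move=> bm; rewrite delta_Amat ?bm //; lia. Qed.

Lemma delta_Amat_mid a b : (m <= b < N - m)%N -> D a b *m B = p ^+ m *: D a b.
Proof.
move=> bm; rewrite delta_Amat; last by lia.
have -> : (b < m)%N = false by lia.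
have -> : (n.*2 - b < m)%N = false by lia.
have -> : (b < N - m)%N by lia.
by rewrite scale0r addr0.
Qed.

Lemma delta_Amat_high a b : (b < m)%N ->
  D a (n.*2 - b) *m B = yv (n.*2 - b) *: D a b.
Proof.
move=> bm; rewrite delta_Amat; last by lia.
have -> : (n.*2 - b < m)%N = false by lia.
have -> : (n.*2 - b < N - m)%N = false by lia.
have -> : (n.*2 - (n.*2 - b) = b)%N by lia.
by rewrite bm scale0r add0r.
Qed.

Lemma Amat_delta_low a b : (a < m)%N ->
  B *m D a b = dlow *: D a b + yv (n.*2 - a) *: D (n.*2 - a) b.
Proof. by move=> am; rewrite Amat_delta ?am //; lia. Qed.

Lemma Amat_delta_mid a b : (m <= a < N - m)%N -> B *m D a b = p ^+ m *: D a b.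
Proof.
move=> am; rewrite Amat_delta; last by lia.
have -> : (a < m)%N = false by lia.
have -> : (n.*2 - a < m)%N = false by lia.
have -> : (a < N - m)%N by lia.
by rewrite scale0r addr0.
Qed.

Lemma Amat_delta_high a b : (a < m)%N ->
  B *m D (n.*2 - a) b = yv a *: D a b.
Proof.
move=> am; rewrite Amat_delta; last by lia.
have -> : (n.*2 - a < m)%N = false by lia.
have -> : (n.*2 - a < N - m)%N = false by lia.
have -> : (n.*2 - (n.*2 - a) = a)%N by lia.
by rewrite am scale0r add0r.
Qed.

(** * Commutation with generators of index at least [m] and with diagonal elements *)

Lemma nat_e_Amat i : (m <= i)%N -> nat_e K i *m B = B *m nat_e K i.
Proof.
move=> mi; have i_lt := ltn_ord i.
by rewrite nat_eD mulmxBl mulmxBr !delta_Amat_mid ?Amat_delta_mid //; lia.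
Qed.

Lemma nat_f_Amat i : (m <= i)%N -> nat_f K i *m B = B *m nat_f K i.
Proof.
move=> mi; have i_lt := ltn_ord i.
by rewrite nat_fD mulmxBl mulmxBr !delta_Amat_mid ?Amat_delta_mid //; lia.
Qed.

(** The off-diagonal entries of A only join an outer index to its mirror image. *)
Lemma diag_Amat (u : 'rV[K]_N) :
    (forall z : 'I_N, (z < m)%N || (rev_ord z < m)%N -> u 0 z = u 0 (rev_ord z)) ->
  diag_mx u *m B = B *m diag_mx u.
Proof.
move=> uE.
have diag_delta (a b : 'I_N) : u 0 a = u 0 b ->
    diag_mx u *m delta_mx a b = delta_mx a b *m diag_mx u.
  move=> uab; apply/matrixP => x z; rewrite mul_diag_mx mul_mx_diag !mxE.
  have [->|] := eqVneq x a; last by rewrite mulr0 mul0r.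
  by have [->|] := eqVneq z b; rewrite ?mulr0 ?mul0r // uab mulrC.
rewrite /Amat expr0 scale1r !(mulmxDl, mulmxDr) !mulmx_sumr !mulmx_suml.
by congr (_ + _ + _); apply: eq_bigr => z zP;
  rewrite -scalemxAl -scalemxAr diag_delta //; apply: uE.
Qed.

Lemma nat_wt_outer i (z : 'I_N) : (m <= i)%N ->
  (z < m)%N || (rev_ord z < m)%N -> nat_wt i z = 0.
Proof.
move=> mi zm; have ? := ltn_ord i; have ? := ltn_ord z.
by rewrite nat_wtE; move: zm => /=; lia.
Qed.

Lemma rev_outer (z : 'I_N) : (z < m)%N || (rev_ord z < m)%N ->
  (rev_ord z < m)%N || (rev_ord (rev_ord z) < m)%N.
Proof. by rewrite rev_ordK orbC. Qed.

Lemma nat_k_Amat i : (m <= i)%N -> nat_k q i *m B = B *m nat_k q i.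
Proof.
move=> mi; apply: diag_Amat => z zP.
by rewrite !mxE !nat_wt_outer // rev_outer.
Qed.

Lemma nat_kV_Amat i : (m <= i)%N -> nat_kV q i *m B = B *m nat_kV q i.
Proof.
move=> mi; apply: diag_Amat => z zP.
by rewrite !mxE !nat_wt_outer // rev_outer.
Qed.

Lemma natrep_Uqh_Amat (b : 'rV[int]_n) : (forall i, (i < m)%N -> b 0 i = 0) ->
  rho (Uqh q b) *m B = B *m rho (Uqh q b).
Proof.
move=> b0; rewrite natrep_Uqh; apply: diag_Amat => z zP.
rewrite !mxE; congr (q ^ _); apply: eq_bigr => i _.
have [/b0 ->|mi] := ltnP i m; first by rewrite !mul0r.
by rewrite !nat_wt_outer // rev_outer.
Qed.

(** * Commutation with the mixed generators X *)

(* In the next three proofs B is replaced by a variable C while products are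
   expanded: rewriting with linearity lemmas would otherwise unfold Amat. *)
Lemma nat_X_Amat_lt i : (i.+1 < m)%N ->
  let X := nat_e K i - (q * yv i.+1 / yv i) *: rho (UF q i) in
  X *m B = B *m X.
Proof.
move=> im /=; rewrite natrep_UF nat_eD.
have -> : (i.+1 == n) = false by lia.
have im0 := ltnW im; have y0 := y_neq0 i im0; have y1 := y_neq0 i.+1 im.
have [C CB] : {C | C = B} by exists B.
rewrite -CB !(mulmxBl, mulmxBr) -!scalemxAl -!scalemxAr !(mulmxBl, mulmxBr).
rewrite -!scalemxAl -!scalemxAr CB.
rewrite !(delta_Amat_low _ _ im) !(delta_Amat_low _ _ im0) !(delta_Amat_high _ _ im)
  !(delta_Amat_high _ _ im0) !(Amat_delta_low _ _ im) !(Amat_delta_low _ _ im0)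
  !(Amat_delta_high _ _ im) !(Amat_delta_high _ _ im0).
rewrite (y_rev _ im) (y_rev _ im0).
have zy0 : yv i * (yv i)^-1 = 1 by apply: mulfV.
have zy1 : yv i.+1 * (yv i.+1)^-1 = 1 by apply: mulfV.
apply/matrixP => u v; rewrite !mxE.
(* A has the same diagonal entry at [i] and [i.+1], so [dlow] cancels and may be any scalar; what
   matters is that both mirrored products of y agree. *)
move: p qp dlow (p ^+ m) (p ^+ (n - m)) => p' qp' d P T.
by ring: qp' zy0 zy1.
Qed.

(** Here X joins index [i], with diagonal entry [dlow], to the central index, with entry [p ^+ m].
    The gap [p ^+ m.+1] is filled by [yv i] times the F part, which fixes the mixture
    coefficient. *)
Lemma nat_X_Amat_n i : i.+1 = m -> m = n ->
  let X := nat_e K i - (yv i * q ^+ m)^-1 *: rho (UF q i) in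
  X *m B = B *m X.
Proof.
move=> im mn /=; rewrite natrep_UF nat_eD im (introT eqP mn).
have im0 : (i < m)%N by lia.
have y0 := y_neq0 i im0.
have m_mid : (m <= m < N - m)%N by lia.
have -> : (n.*2 - m = m)%N by lia.
have [C CB] : {C | C = B} by exists B.
rewrite -CB !(mulmxBl, mulmxBr) -!scalemxAl -!scalemxAr !(mulmxBl, mulmxBr).
rewrite -!scalemxAl -!scalemxAr CB.
rewrite !(delta_Amat_low _ _ im0) !(delta_Amat_mid _ _ m_mid)
  !(delta_Amat_high _ _ im0) !(Amat_delta_low _ _ im0)
  !(Amat_delta_mid _ _ m_mid) !(Amat_delta_high _ _ im0).
rewrite (y_rev _ im0).
(* By definition [n <= m] is the equation [n - m == 0], which reduces [dlow] to
   [p ^+ m * (1 - p)]. *)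
apply/matrixP => u v; rewrite !mxE /dlow
  (eqnP (eq_leq (esym mn))) expr0 invfM -exprVn -/p.
have zy0 : yv i * (yv i)^-1 = 1 by apply: mulfV.
move: p qp (p ^+ m) => p' qp' P.
by ring: qp' zy0.
Qed.

(** The same balance, where the gap between [p ^+ m] and [dlow] is now
    [p ^+ m.+1 * p ^+ (n - m).*2]; the last factor is the one in the second term of [natrep_UtF]. *)
Lemma nat_X_Amat_mid i : i.+1 = m -> (m < n)%N ->
  let X := D i m - (p ^+ 2) *: D (n.*2 - m) (n.*2 - i)
    + ((-1) ^+ (n - m).+1 / (yv i * q ^+ m.+1)) *: rho (UtF m q i) in
  X *m B = B *m X.
Proof.
move=> im mn /=; rewrite natrep_UtF //.
have im0 : (i < m)%N by lia.
have y0 := y_neq0 i im0.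
have m_mid : (m <= m < N - m)%N by lia.
have rm_mid : (m <= n.*2 - m < N - m)%N by lia.
rewrite scalerA.
(* The sign of the mixture coefficient absorbs the one from the iterated brackets, up to -1. *)
have -> : (-1) ^+ (n - m).+1 / (yv i * q ^+ m.+1) * (-1) ^+ (n - m) =
    - (p ^+ m * p / yv i).
  have sgn : (-1) ^+ (n - m) * (-1) ^+ (n - m) = 1 :> K.
    by rewrite -expr2 sqrr_sign.
  rewrite exprS invfM -exprVn exprSr -/p.
  by ring: sgn.
have [C CB] : {C | C = B} by exists B.
rewrite -CB !(mulmxDl, mulmxDr, mulNmx, mulmxN) -!scalemxAl -!scalemxAr.
rewrite !(mulmxDl, mulmxDr, mulNmx, mulmxN) -!scalemxAl -!scalemxAr CB.
rewrite !(delta_Amat_low _ _ im0) !(delta_Amat_mid _ _ m_mid)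
  !(delta_Amat_high _ _ im0) !(Amat_delta_low _ _ im0)
  !(Amat_delta_mid _ _ rm_mid) !(Amat_delta_high _ _ im0).
rewrite (y_rev _ im0).
have -> : p ^+ (n - m).*2 = (p ^+ (n - m)) ^+ 2 by rewrite -muln2 exprM.
apply/matrixP => u v; rewrite !mxE /dlow.
have zy0 : yv i * (yv i)^-1 = 1 by apply: mulfV.
move: p qp (p ^+ m) (p ^+ (n - m)) => p' qp' P T.
by ring: qp' zy0.
Qed.

Lemma natrep_UX_Amat i : (i < m)%N ->
  rho (UX m q y i) *m B = B *m rho (UX m q y i).
Proof.
move=> im; have i_lt := ltn_ord i.
have -> : rho (UX m q y i) = rho (Uqh q (talpha m i - alpha i)) *m nat_e K i
    + mixture_coef m q y i *: rho (UtF m q i).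
  by rewrite /UX rmorphD /= linearZ_LR /= rmorphM /= natrep_e.
(* The root difference is zero unless [i.+1 = m], and then it sums over the indices from [m] on, of
   which there are none if [m = n]. *)
have Uqh1 : (i.+1 != m) || (m == n) ->
    rho (Uqh q (talpha m i - alpha i)) = 1%:M.
  move=> iP; rewrite /Uqh big1 ?rmorph1 // => l _.
  have -> // : (talpha m i - alpha i) 0 l = 0.
  have := ltn_ord l; rewrite talphaB; case: ifP => //; lia.
rewrite /mixture_coef; case: ifP => [im1|im1].
  have im' : (i.+1 == m) = false by lia.
  rewrite Uqh1 ?im' // mul1mx scaleNr /UtF im'; exact: nat_X_Amat_lt.
have {im1 im} im : i.+1 = m by lia.
case: ifP => [/eqP mn|mn].
  rewrite Uqh1 ?(introT eqP mn) ?orbT // mul1mx scaleNr.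
  have -> : UtF m q i = UF q i.
    have := val_ord_above n i; rewrite /UtF im eqxx mn subnn.
    by case: (ord_above i).
  exact: nat_X_Amat_n.
have {}mn : (m < n)%N by lia.
have -> : rho (Uqh q (talpha m i - alpha i)) *m nat_e K i =
    D i m - (p ^+ 2) *: D (n.*2 - m) (n.*2 - i).
  rewrite natrep_Uqh nat_eD im mulmxBr !diag_delta_vidx !mxE.
  (* Row [i] has weight 0 and row [n.*2 - m] has weight -2, whence the factor [p ^+ 2]. *)
  have wE (j : 'I_N) : \sum_(l < n) (talpha m i - alpha i) 0 l * nat_wt l j =
      2 * ((j == m :> nat)%:R - (j == n.*2 - m :> nat)%N%:R).
    rewrite -im -sum_nat_wt mulr_sumr [RHS]big_mkcond /=.
    apply: eq_bigr => l _; rewrite im talphaB im eqxx /=.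
    by case: ifP => _; rewrite ?mul0r.
  rewrite !wE !vidxE; try lia.
  have -> : (i == m :> nat) = false by lia.
  have -> : (i == n.*2 - m :> nat)%N = false by lia.
  have -> : (n.*2 - m == m)%N = false by lia.
  by rewrite eqxx subrr mulr0 expr0z scale1r /= sub0r mulrN mulr1 exprN_p.
exact: nat_X_Amat_mid.
Qed.

End Stabilizer.

(** * From the generators to the whole subalgebra *)

Lemma natrep_Uqk_Amat (K : fieldType) (q : K) (q_neq0 : q != 0)
    (q_nroot : forall l : nat, (0 < l)%N -> q ^+ l != 1)
    (n m : nat) (le_mn : (m <= n)%N)
    (y : 'I_n.*2.+1 -> K)
    (y_inv : forall i : 'I_n.*2.+1, (i < m)%N || (rev_ord i < m)%N ->
       y i * y (rev_ord i) = q ^ (- (n.*2.+1)%:Z))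
    (s : bool) (x : Uq n q) :
  Uqk m y x ->
  natrep q_neq0 q_nroot x *m Amat m q y s
  = Amat m q y s *m natrep q_neq0 q_nroot x.
Proof.
have -> : Amat m q y s = (-1) ^+ s *: Amat m q y false.
  by rewrite /Amat expr0 scale1r.
move=> xk; rewrite -scalemxAl -scalemxAr; congr (_ *: _).
(* The commutant of A is a subalgebra, so the generators decide. *)
elim: xk => [_ [] i mi||c z _ IH|z t _ IHz _ IHt|z t _ IHz _ IHt].
- by rewrite natrep_e nat_e_Amat.
- by rewrite natrep_f nat_f_Amat.
- by rewrite natrep_k nat_k_Amat.
- by rewrite natrep_kV nat_kV_Amat.
- exact: natrep_UX_Amat.
(* A nonzero entry at [l] forces [i.+1 = m] and [i < l], hence [m <= l]. *)
- apply: natrep_Uqh_Amat => // l lm; rewrite talphaB; case: ifP => //; lia.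
- apply: natrep_Uqh_Amat => // l lm; rewrite mxE talphaB; case: ifP => //; lia.
- by rewrite rmorph1 mul1mx mulmx1.
- by rewrite [natrep _ _ _]linearZ_LR /= -[LHS]scalemxAl IH -[RHS]scalemxAr.
- by rewrite rmorphD mulmxDl mulmxDr IHz IHt.
- by rewrite rmorphM /= -[_ * _]/(_ *m _) -mulmxA IHt !mulmxA IHz.
Qed.

Theorem mainTheorem4 (R : realType) (q : R[i]) (q_neq0 : q != 0)
    (q_nroot : forall l : nat, (0 < l)%N -> q ^+ l != 1)
    (n m : nat) (le_mn : (m <= n)%N)
    (y : 'I_n.*2.+1 -> R[i])
    (y_inv : forall i : 'I_n.*2.+1, (i < m)%N || (rev_ord i < m)%N ->
       y i * y (rev_ord i) = q ^ (- (n.*2.+1)%:Z))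
    (s : bool) (x : Uq n q) :
  Uqk m y x ->
  natrep q_neq0 q_nroot x *m Amat m q y s
  = Amat m q y s *m natrep q_neq0 q_nroot x.
Proof. exact: natrep_Uqk_Amat. Qed.
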